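(* Let $m \in \mathbb{N}=\{0,1,2,\dots\}$ and let $k$ be a positive integer. Then $$D_{2k-1,2-k-m}(N) = 0 \quad \text{for } N = 1, 2, \ldots, m+k-2,$$ and for all $n \in \mathbb{N}$ $$D_{2k-1,2-k-m}(n+m+k-1) = (-1)^{\binom{m+k-1}{2}} D_{2k-1,1-k+m}(n).$$
   Context: Let $C_n = \frac{1}{n+1}\binom{2n}{n}$ be the Catalan numbers and $c(x) = \sum_{n\ge 0} C_n x^n$ their generating function (a formal power series). For a positive integer $k$ and $n \ge 0$ let $C_{k,n} = [x^n]\, c(x)^k$ be the coefficient of $x^n$ in $c(x)^k$, and set $C_{k,n}=0$ for $n<0$. For $M \in \mathbb{Z}$ and integers $K, N \ge 1$ define the Hankel determinant $$D_{K,M}(N) = \det\left(C_{K,i+j+M}\right)_{i,j=0}^{N-1},$$ and set $D_{K,M}(0)=1$. A range $N=1,\dots,r$ with $r\le 0$ is empty. *)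

(* Defs.v *)
From mathcomp Require Import all_boot all_order all_algebra.
Set Implicit Arguments.
Unset Strict Implicit.
Unset Printing Implicit Defensive.
Import GRing.Theory.
Local Open Scope ring_scope.

(* A formal power series over R is represented by its sequence
   of coefficients nat -> R; multiplication is the Cauchy product. *)
Definition fps_one (R : nzRingType) : nat -> R := fun n => (n == 0%N)%:R.

Definition fps_mul (R : nzRingType) (a b : nat -> R) : nat -> R :=
  fun n => \sum_(i < n.+1) a i * b (n - i)%N.

Definition fps_exp (R : nzRingType) (a : nat -> R) (k : nat) : nat -> R :=
  iter k (fps_mul a) (fps_one R).

Definition catalan (n : nat) : rat := n.+1%:R^-1 * 'C(2 * n, n)%:R.

Definition catalan_conv (k : nat) (n : int) : rat :=
  match n with
  | Posz p => fps_exp catalan k p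
  | Negz _ => 0
  end.

(* For N = 0 this is the determinant of the empty matrix, which is 1. *)
Definition hankel_det (K : nat) (M : int) (N : nat) : rat :=
  \det (\matrix_(i < N, j < N) catalan_conv K (i%:Z + j%:Z + M)).

(* Main.v *)
Require Import Defs.
From mathcomp Require Import all_boot all_order all_algebra.
From mathcomp Require Import ring zify.
Set Implicit Arguments.
Unset Strict Implicit.
Unset Printing Implicit Defensive.
Import GRing.Theory Num.Theory.
Local Open Scope ring_scope.

(** Write K = 2k - 1 and d = m + k - 1.  The matrix on the left-hand side has
    (i, j) entry C_(K, i+j+1-d), so its first nonzero antidiagonal is i+j = d-1;
    a determinant of size less than d has a zero first row, which is the first
    claim.

    For the second claim let a be the coefficients of c^K and b those of c^(-K).
    Multiplying the matrix A = (a_(i+j+1-d)) of size d + n on the left by the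
    lower triangular Toeplitz matrix of b forms, in each column, partial
    convolutions of b with a shift of a.  In the first d columns these are the
    complete coefficients of b * a = 1, and leave an antidiagonal of ones above
    zeros.  In the other columns each is 0 minus the missing terms, which makes
    the lower right block the product of the Hankel matrix of - b_(d+1+i+j) with
    an upper triangular Toeplitz matrix of a.  Taking determinants relates the
    Hankel determinants of a and of - b ([det_hankel_inv]); the antidiagonal
    block contributes the sign (-1)^C(d,2).

    It remains to recognise the coefficients of - c^(-K) of index at least k as
    those of x^K c^K ([catalan_inv_exp_tail]).  Put y = x c and z = 1/c.  The
    equation c = 1 + x c^2 says y + z = 1 and y z = x, so y^K + z^K is a
    polynomial in x of degree at most K/2 < k ([coef_power_sum]), as one sees
    from the Newton recurrence for power sums.  Only indices at least d + 1 >= k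
    of b occur in the determinant, and - b_(d+1+i+j) = a_(d+1+i+j-K) is the entry
    C_(K, i+j+1-k+m) on the right-hand side. *)

(** * Power series through truncated polynomials *)

(** Identities between power series are proved in the commutative ring of
    polynomials, where they hold up to the precision n. *)
Definition agree (R : nzRingType) (n : nat) (p : {poly R}) (a : nat -> R) :=
  forall i, (i < n)%N -> p`_i = a i.

Lemma agree_poly (R : nzRingType) n (a : nat -> R) :
  agree n (\poly_(i < n) a i) a.
Proof. by move=> i lt_in; rewrite coef_poly lt_in. Qed.

Lemma agree_one (R : nzRingType) n : agree n 1 (fps_one R).
Proof. by move=> i _; rewrite coef1. Qed.

Lemma agree_mul (R : nzRingType) n p q (a b : nat -> R) :
  agree n p a -> agree n q b -> agree n (p * q) (fps_mul a b).
Proof.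
move=> pa qb i lt_in; rewrite coefM; apply: eq_bigr => j _.
by rewrite pa ?qb //; have := ltn_ord j; lia.
Qed.

Lemma agree_exp (R : nzRingType) n p (a : nat -> R) K :
  agree n p a -> agree n (p ^+ K) (fps_exp a K).
Proof.
move=> pa; elim: K => [|K IHK]; first exact: agree_one.
by rewrite exprS; apply: agree_mul.
Qed.

Lemma fps_exp_inv (R : comNzRingType) (a b : nat -> R) K :
  fps_mul b a =1 fps_one R ->
  fps_mul (fps_exp b K) (fps_exp a K) =1 fps_one R.
Proof.
move=> ba1 i.
pose p := \poly_(j < i.+1) a j; pose q := \poly_(j < i.+1) b j.
have pa : agree i.+1 p a by apply: agree_poly.
have qb : agree i.+1 q b by apply: agree_poly.
have qp1 : agree i.+1 (q * p) (fps_one R).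
  by move=> j lt_ji; rewrite -ba1; apply: agree_mul lt_ji.
rewrite -(agree_mul (agree_exp K qb)
  (agree_exp K pa)) // -exprMn.
rewrite (agree_exp K qp1) //.
by rewrite -(agree_exp K (@agree_one R i.+1)) // expr1n coef1.
Qed.

(** Since y + z = 1 and y z = X, the power sums e_K = y^K + z^K satisfy
    e_(K+2) = e_(K+1) - X e_K with e_0 = 2 and e_1 = 1, so the degree bound grows
    by one for every two steps in K. *)
Lemma coef_power_sum (R : comNzRingType) n (y z : {poly R}) :
  y + z = 1 -> agree n (y * z) (fun i => 'X`_i) ->
  forall K i, (i < n)%N -> (K < 2 * i)%N -> (y ^+ K + z ^+ K)`_i = 0.
Proof.
move=> yz1 yzX K.
(* The recurrence has order two, so the induction carries K and K + 1. *)
suff: (forall i, (i < n)%N -> (K < 2 * i)%N -> (y ^+ K + z ^+ K)`_i = 0) /\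
  (forall i, (i < n)%N -> (K.+1 < 2 * i)%N ->
     (y ^+ K.+1 + z ^+ K.+1)`_i = 0) by case.
elim: K => [|K [IHK IHK1]].
  split=> i _ i_gt0; rewrite ?expr0 ?expr1 ?yz1 ?coefD coef1.
    by rewrite (_ : (i == 0%N) = false) ?addr0 //; lia.
  by rewrite (_ : (i == 0%N) = false) //; lia.
split=> // i lt_in lt_Ki.
have -> : y ^+ K.+2 + z ^+ K.+2
    = (y + z) * (y ^+ K.+1 + z ^+ K.+1) - y * z * (y ^+ K + z ^+ K).
  by rewrite !exprS; ring.
rewrite yz1 mul1r coefB IHK1 ?sub0r //; last by lia.
have -> : (y * z * (y ^+ K + z ^+ K))`_i = ('X * (y ^+ K + z ^+ K))`_i.
  rewrite !coefM; apply: eq_bigr => j _.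
  by rewrite yzX //; have := ltn_ord j; lia.
rewrite coefXM (_ : (i == 0%N) = false); last by lia.
by rewrite IHK ?oppr0 //; lia.
Qed.

(** * The Catalan series and its inverse *)

Lemma catalanS n : n.+2%:R * catalan n.+1 = (4 * n + 2)%:R * catalan n.
Proof.
have binS : ('C(2 * n.+1, n.+1) * n.+1 = (4 * n + 2) * 'C(2 * n, n))%N.
  have := mul_bin_diag (2 * n.+1) n; have := mul_bin_down (2 * n).+1 n.
  rewrite (_ : (2 * n.+1).-1 = (2 * n).+1); last by lia.
  rewrite /= (_ : ((2 * n).+1 - n = n.+1)%N); last by lia.
  by nia.
rewrite /catalan mulVKf ?pnatr_eq0 //.
apply: (@mulIf _ n.+1%:R); first by rewrite pnatr_eq0.
rewrite -natrM binS natrM.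
by field; rewrite addrC natr1 pnatr_eq0.
Qed.

(** The terms of index i and n - i of the convolution are equal, and their
    weights i + 1 and n - i + 1 add up to n + 2. *)
Lemma weighted_conv (a : nat -> rat) n :
  2%:R * \sum_(i < n.+1) i.+1%:R * (a i * a (n - i)%N)
  = n.+2%:R * \sum_(i < n.+1) a i * a (n - i)%N.
Proof.
rewrite mulr_natl mulr2n {2}(reindex_inj rev_ord_inj) /= -big_split mulr_sumr.
apply: eq_bigr => i _ /=; have := ltn_ord i => lt_in.
rewrite subSS (subKn (_ : i <= n)%N) //.
rewrite [a (n - i)%N * _]mulrC -mulrDl -natrD.
by congr (_%:R * _); lia.
Qed.

(** The weighted convolution of order n + 1 is (n + 3)/2 times the convolution of
    order n + 1 by symmetry.  The recurrence [catalanS] absorbs the weight i + 1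
    and turns it into a weighted convolution of order n, which symmetry evaluates
    again: the unweighted convolutions therefore obey the same first order
    recurrence as the Catalan numbers. *)
Lemma catalan_conv2 n : \sum_(i < n.+1) catalan i * catalan (n - i) = catalan n.+1.
Proof.
elim: n => [|n IHn].
  by rewrite big_ord_recl big_ord0 /catalan.
apply: (@mulfI _ n.+3%:R); first by rewrite pnatr_eq0.
rewrite -weighted_conv big_ord_recl /= subn0 mul1r.
have -> : catalan 0 = 1 by rewrite /catalan.
under eq_bigr => i _ do
  rewrite /bump /= add1n subSS mulrA catalanS -mulrA.
have -> : \sum_(i < n.+1) (4 * i + 2)%:R * (catalan i * catalan (n - i))
   = 2%:R * (2%:R * \sum_(i < n.+1) i.+1%:R * (catalan i * catalan (n - i)))
     - 2%:R * \sum_(i < n.+1) catalan i * catalan (n - i).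
  rewrite !mulr_sumr -sumrB; apply: eq_bigr => i _.
  by rewrite natrD natrM -natr1; ring.
rewrite weighted_conv IHn (catalanS n.+1) natrD natrM -!natr1; ring.
Qed.

(** The coefficients of 1/c = 1 - x c. *)
Definition catalan_inv (n : nat) : rat := if n is j.+1 then - catalan j else 1.

Lemma catalan_invP : fps_mul catalan_inv catalan =1 fps_one rat.
Proof.
case=> [|n]; rewrite /fps_mul big_ord_recl /= ?big_ord0 ?mul1r //.
rewrite subn0 -catalan_conv2 -big_split /= big1 // => i _.
by rewrite /bump /= add1n subSS mulNr subrr.
Qed.

(** [coef_power_sum] for y = x c and z = 1/c: beyond degree K/2 the coefficients
    of z^K and of y^K = x^K c^K cancel. *)
Lemma catalan_inv_exp_tail K n : (K < 2 * n)%N ->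
  fps_exp catalan_inv K n
  = - (if (n < K)%N then 0 else fps_exp catalan K (n - K)).
Proof.
move=> ltKn.
pose p := \poly_(i < n.+1) catalan i; pose z := 1 - 'X * p.
have pc : agree n.+1 p catalan by apply: agree_poly.
have zc : agree n.+1 z catalan_inv.
  case=> [|i] lt_in; rewrite coefB coef1 coefXM /= ?subr0 // sub0r pc //.
  by lia.
have yzX : agree n.+1 ('X * p * z) (fun i => 'X`_i).
  move=> i lt_in; rewrite -mulrA (mulrC p) coefXM coefX.
  case: i lt_in => [|i] lt_in //=.
  rewrite (agree_mul zc pc) ?catalan_invP //.
  by lia.
have := coef_power_sum (subrKC ('X * p) 1) yzX (leqnn _) ltKn.
rewrite coefD exprMn coefXnM (agree_exp K zc) // => /eqP.
rewrite addrC addr_eq0 => /eqP ->.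
by case: ltnP => // leKn; rewrite (agree_exp K pc) //; lia.
Qed.

(** * Hankel determinants of inverse power series *)

Lemma det_antidiag (R : comNzRingType) d :
  \det (\matrix_(i < d, j < d) ((i + j).+1 == d)%:R) = (-1) ^+ 'C(d, 2) :> R.
Proof.
elim: d => [|d IHd]; first by rewrite det_mx00.
rewrite (expand_det_row _ ord0) (bigD1 ord_max) //= big1 ?addr0 => [|j jmax].
  rewrite mxE add0n eqxx mul1r /cofactor add0n binS bin1 exprD -IHd mulrC.
  congr (\det _ * _); apply/matrixP => i j; rewrite !mxE lift_max lift0.
  by rewrite addSn eqSS.
rewrite mxE add0n eqSS (_ : (j == d :> nat) = false) ?mul0r //.
by apply/eqP => jd; case/eqP: jmax; apply: val_inj.
Qed.

Definition lower_toeplitz (R : nzRingType) n (b : nat -> R) : 'M[R]_n :=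
  \matrix_(i < n, j < n) if (j <= i)%N then b (i - j)%N else 0.

Lemma det_lower_toeplitz (R : comNzRingType) n (b : nat -> R) :
  \det (lower_toeplitz n b) = b 0%N ^+ n.
Proof.
rewrite det_trig; last first.
  by apply/is_trig_mxP => i j lt_ij; rewrite mxE leqNgt lt_ij.
by under eq_bigr => i _ do rewrite mxE leqnn subnn; rewrite prodr_const card_ord.
Qed.

Lemma sum_lower_toeplitz (R : nzRingType) n (b F : nat -> R) i : (i < n)%N ->
  \sum_(l < n) (if (l <= i)%N then b (i - l)%N else 0) * F l
  = \sum_(t < i.+1) b t * F (i - t)%N.
Proof.
move=> lt_in; rewrite [RHS](reindex_inj rev_ord_inj) /=.
rewrite (big_ord_widen n (fun t => b (i.+1 - t.+1)%N * F (i - (i.+1 - t.+1))%N)) //.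
rewrite [RHS]big_mkcond /=; apply: eq_bigr => l _; rewrite ltnS subSS.
by case: leqP => [le_li|_]; rewrite ?mul0r // subKn.
Qed.

(** The coefficient of index l of the Laurent series x^(d-1) a; the offset d - 1
    lets d = 0 stand for a shift to the left. *)
Definition shifted (R : nzRingType) (a : nat -> R) (d l : nat) : R :=
  if (d <= l.+1)%N then a (l.+1 - d)%N else 0.

(** For j < d no term of the coefficient of b * a of index i + j + 1 - d is cut
    off by the bound t <= i. *)
Lemma conv_shifted_lt (R : comNzRingType) (a b : nat -> R) d i j : (j < d)%N ->
  fps_mul b a =1 fps_one R ->
  \sum_(t < i.+1) b t * shifted a d (i - t + j) = ((i + j).+1 == d)%:R.
Proof.
move=> lt_jd ba1; rewrite /shifted.
case: (leqP d (i + j).+1) => [le_d|lt_d]; last first.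
  rewrite (_ : (_ == _) = false); last by lia.
  apply: big1 => t _; rewrite ifF ?mulr0 //; have := ltn_ord t; lia.
have := ba1 ((i + j).+1 - d)%N; rewrite /fps_one /fps_mul.
rewrite (_ : (_ - d == 0)%N = ((i + j).+1 == d)) => [<-|]; last by lia.
rewrite (big_ord_widen i.+1 (fun t => b t * a ((i + j).+1 - d - t)%N)); last by lia.
rewrite [RHS]big_mkcond /=; apply: eq_bigr => t _; have := ltn_ord t => lt_ti.
case: ifP => h1; case: ifP => h2; rewrite ?mulr0 //; try lia.
by congr (_ * a _); lia.
Qed.

(** The left-hand side is the part t <= i of the coefficient of b * a of positive
    index i + v + 1, which vanishes; the right-hand side is minus the part
    t > i, indexed by w = i + v + 1 - t. *)
Lemma conv_shifted_ge (R : comNzRingType) (a b : nat -> R) d i v :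
  fps_mul b a =1 fps_one R ->
  \sum_(t < i.+1) b t * shifted a d (i - t + (d + v))
  = \sum_(w < v.+1) a w * - b ((i + v).+1 - w)%N.
Proof.
move=> ba1; have := ba1 (i + v.+1)%N; rewrite /fps_mul /fps_one.
rewrite (_ : (_ == 0)%N = false); last by lia.
rewrite -addSn big_split_ord /= => /eqP; rewrite addr_eq0 => /eqP e.
transitivity (\sum_(t < i.+1) b t * a (i + v.+1 - t)%N).
  apply: eq_bigr => t _; have := ltn_ord t => lt_ti; rewrite /shifted ifT; last by lia.
  by congr (_ * a _); lia.
rewrite e [in RHS](reindex_inj rev_ord_inj) /= -sumrN.
apply: eq_bigr => w _; have := ltn_ord w => lt_wv.
rewrite mulrN mulrC; congr (- (a _ * b _)); lia.
Qed.

(** Multiplication by the Toeplitz matrix of b makes the Hankel matrix block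
    triangular, with the antidiagonal matrix and the Hankel matrix of - b times
    a Toeplitz matrix of a on the diagonal.  The Toeplitz factors contribute
    b_0^(d+n) and a_0^n, and b_0 is the inverse of a_0. *)
Lemma det_hankel_inv (R : comNzRingType) (a b : nat -> R) d n :
  fps_mul b a =1 fps_one R ->
  \det (\matrix_(i < d + n, j < d + n) shifted a d (i + j))
  = (-1) ^+ 'C(d, 2) * a 0%N ^+ (d + n.*2)
    * \det (\matrix_(i < n, j < n) - b (d + i + j).+1).
Proof.
move=> ba1; set A := \matrix_(i, j) _; set G := \matrix_(i, j) _.
have a0b0 : a 0%N * b 0%N = 1.
  by have := ba1 0%N; rewrite /fps_mul big_ord1 mulrC.
pose J : 'M[R]_d := \matrix_(i < d, j < d) ((i + j).+1 == d)%:R.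
have LA : lower_toeplitz (d + n) b *m A
    = block_mx J (ursubmx (lower_toeplitz (d + n) b *m A)) 0
               (G *m (lower_toeplitz n a)^T).
  rewrite -[LHS]submxK.
  have LAE (i j : 'I_(d + n)) : (lower_toeplitz (d + n) b *m A) i j
      = \sum_(t < i.+1) b t * shifted a d (i - t + j).
    rewrite mxE -(@sum_lower_toeplitz _ (d + n) b (fun l => shifted a d (l + j))) //.
    by apply: eq_bigr => l _; rewrite !mxE.
  congr block_mx; apply/matrixP => i j; rewrite !mxE.
  - have := LAE (lshift n i) (lshift n j); rewrite mxE => ->.
    by rewrite conv_shifted_lt /=.
  - have := LAE (rshift d i) (lshift n j); rewrite mxE => ->.
    rewrite conv_shifted_lt //= (_ : (_ == _) = false) //; lia.
  have := LAE (rshift d i) (rshift d j); rewrite mxE => ->.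
  rewrite conv_shifted_ge //=.
  transitivity (\sum_(w < j.+1) a w * - b (d + i + (j - w)).+1).
    apply: eq_bigr => w _; congr (_ * - b _); have := ltn_ord w; lia.
  rewrite -(@sum_lower_toeplitz _ n a (fun w => - b (d + i + w).+1)) //.
  by apply: eq_bigr => w _; rewrite !mxE mulrC.
have detLA : b 0%N ^+ (d + n) * \det A
    = (-1) ^+ 'C(d, 2) * (\det G * a 0%N ^+ n).
  rewrite -(det_lower_toeplitz (d + n) b) -det_mulmx LA det_ublock.
  by rewrite det_antidiag det_mulmx det_tr det_lower_toeplitz.
transitivity ((a 0%N * b 0%N) ^+ (d + n) * \det A).
  by rewrite a0b0 expr1n mul1r.
rewrite exprMn -[LHS]mulrA detLA.
by rewrite -addnn addnA [in RHS]exprD; ring.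
Qed.

(** * Hankel determinants of odd convolution powers *)

Theorem theorem2 (m k : nat) (hk : (0 < k)%N) :
  (forall N : nat, (1 <= N <= m + k - 2)%N ->
     hankel_det (2 * k - 1) (2 - k%:Z - m%:Z) N = 0) /\
  (forall n : nat,
     hankel_det (2 * k - 1) (2 - k%:Z - m%:Z) (n + m + k - 1) =
     (-1) ^+ 'C(m + k - 1, 2) * hankel_det (2 * k - 1) (1 - k%:Z + m%:Z) n).
Proof.
set K := (2 * k - 1)%N; set d := (m + k - 1)%N.
have convE (l : nat) (q : int) (e : nat) : q = l%:Z - e%:Z ->
    catalan_conv K q = if (l < e)%N then 0 else fps_exp catalan K (l - e).
  move=> ->; case: ltnP => [lt_le|le_el].
    case E: (l%:Z - e%:Z) => [p|//]; lia.
  by rewrite subzn.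
have a0 : fps_exp catalan K 0 = 1.
  elim: K {convE} => [//|K IHK].
  by rewrite /= /fps_mul big_ord1 IHK /catalan.
(* The first row is zero because j <= N < m + k - 2 for every column j. *)
split=> [[//|N] /andP[_ leN]|n].
  rewrite /hankel_det (expand_det_row _ ord0) big1 // => j _.
  rewrite mxE (@convE j _ (m + k - 2)%N) /=; last by lia.
  by rewrite ifT ?mul0r //; have := ltn_ord j; lia.
rewrite (_ : n + m + k - 1 = d + n)%N; last by lia.
transitivity (\det (\matrix_(i < d + n, j < d + n)
    shifted (fps_exp catalan K) d (i + j))).
  congr (\det _); apply/matrixP => i j; rewrite !mxE /shifted.
  rewrite (@convE (i + j).+1 _ d); last by lia.
  by rewrite leqNgt if_neg.
rewrite (det_hankel_inv _ _ (fps_exp_inv K catalan_invP)).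
rewrite a0 expr1n mulr1; congr (_ * \det _); apply/matrixP => i j; rewrite !mxE.
rewrite catalan_inv_exp_tail; last by lia.
by rewrite opprK (@convE (d + i + j).+1 _ K) //; lia.
Qed.
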